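(* Let $\mathbf{\Theta}$ be the set of all pairs $(S,x)$ where $S\in\mathbf{\Omega}$ and $x\in\Gamma(\mathbb{X}_s(S),\mathcal{O}^c)$. On $\mathbf{\Theta}$ define binary operations $$(S,x)\wedge(T,y)=(S\cap T,\ x|_{\mathbb{X}_s(S)\cap\mathbb{X}_s(T)}),$$ $$(S,x)\vee(T,y)=(S\cup T,\ y|_{\mathbb{X}_s(T)}\cup x|_{\mathbb{X}_s(S)-\mathbb{X}_s(T)}),$$ where the second component of the latter is the function equal to $y$ on $\mathbb{X}_s(T)$ and to $x$ on $\mathbb{X}_s(S)-\mathbb{X}_s(T)$. Then: (a) With these operations $\mathbf{\Theta}$ is a noncommutative frame, and its semiclassical shadow satisfies $[\mathbf{\Theta}]\simeq\mathbf{\Omega}$ (as lattices). (b) There is an embedding of noncommutative frames $\mathbf{\Omega}\hookrightarrow\mathbf{\Theta}$ given by $S\mapsto(S,1|_{\mathbb{X}_s(S)})$, where $1|_{\mathbb{X}_s(S)}$ is the constant function $1$. (c) $(S,x)$ commutes with $(T,y)$ for $\wedge$, or for $\vee$, if and only if $x|_{\mathbb{X}_s(S)\cap\mathbb{X}_s(T)}=y|_{\mathbb{X}_s(S)\cap\mathbb{X}_s(T)}$. (d) Associate to each $(S,x)\in\mathbf{\Theta}$ the ''open'' set $\mathbb{X}_{nc}(S,x)=\{([s],x([s])) : [s]\in\mathbb{X}_s(S)\}$ in $\mathbb{E}=[\mathbb{S}]\times\{0,1\}$. When $\mathbb{E}$ carries the topology generated by these sets, the projection on the first factor makes $\mathbb{E}$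 into an étale space over $[\mathbb{S}]$ with respect to the patch topology on $[\mathbb{S}]$.
   Context: $\mathbb{N}^\times_+$ is the multiplicative monoid of strictly positive integers. $\mathbf{\Omega}$ is the set of its ideals (subsets, possibly empty, closed under taking multiples), a lattice under $\cap$ and $\cup$ with bottom $\emptyset$. A supernatural number is a formal product $s=\prod_p p^{s_p}$ over all primes with $s_p\in\mathbb{N}\cup\{\infty\}$; multiplication adds exponents and divisibility means inequality of all exponents. $\mathbb{S}$ is the set of supernatural numbers, and $[\mathbb{S}]$ is its set of classes $[s]$ under: $s\sim s'$ iff ($s_p=\infty\Leftrightarrow s'_p=\infty$ for all $p$) and $s_p=s'_p$ for all but finitely many $p$. For $S\in\mathbf{\Omega}$ put $\mathbb{X}_s(S)=\{[s]\in[\mathbb{S}] : \exists n_1,n_2,\ldots\in S \text{ (an infinite sequence, repetitions allowed) with } \prod_{i=1}^\infty n_i\mid s\}$; this is independent of the representative. These are the basic open sets of the sieve topology on $[\mathbb{S}]$. The patch topology on $[\mathbb{S}]$ is the topology whose open sets are unions of locally closed subsets (intersections of an open and a closed set) of the sieve topology. $\mathcal{O}^c$ is the sheaf of constructible truth fluctuations: $\Gamma(\mathbb{X}_s(S),\mathcal{O}^c)$ is the set of functions $x:\mathbb{X}_s(S)\to\{0,1\}$ that are continuous for the induced patch topology on $\mathbb{X}_s(S)$ and the discrete topology on $\{0,1\}$. A noncommutative frame is a set with binary operations $\wedge,\vee$ and an element $0$ such that for all $x,y,z$: (1) $x\wedge(y\wedge z)=(x\wedge y)\wedge z$; (2) $x\vee(y\vee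 z)=(x\vee y)\vee z$; (3) $x\wedge x=x$; (4) $x\vee x=x$; (5) $x\wedge(x\vee y)=x=x\vee(x\wedge y)$; (6) $(y\vee x)\wedge x=x=(y\wedge x)\vee x$; (7) $x\wedge0=0=0\wedge x$; (8) $x\vee0=x=0\vee x$; (9) $x\wedge(y\vee z)=(x\wedge y)\vee(x\wedge z)$; (10) $(y\vee z)\wedge x=(y\wedge x)\vee(z\wedge x)$; (11) $x\wedge y\wedge x=x\wedge y$; (12) $x\vee y\vee x=y\vee x$; (13) $x\wedge y\wedge z=x\wedge z\wedge y$. Its semiclassical shadow $[\mathbf{\Theta}]$ is the set of equivalence classes, with induced operations, for the relation $x\sim y\Leftrightarrow x\wedge y\wedge x=x$ and $y\wedge x\wedge y=y$; it is a (commutative) lattice. The zero of $\mathbf{\Theta}$ is $(\emptyset,\text{empty function})$. Morphisms of noncommutative frames preserve $\wedge,\vee,0$. An étale space over $X$ is a space with a local homeomorphism to $X$. *)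

(* Defs.v *)
From HB Require Import structures.
Set Warnings "-notation-overridden,-notation-incompatible-prefix".
From mathcomp Require Import all_boot all_classical.
From mathcomp Require Import topology.

Set Implicit Arguments.
Unset Strict Implicit.
Unset Printing Implicit Defensive.

Local Open Scope classical_set_scope.
Local Open Scope quotient_scope.

(* A set of strictly positive integers, possibly empty, closed under taking
   multiples. *)
Record Omega := MkOmega {
  ocar :> set nat;
  ocar_gt0 : forall n, ocar n -> 0 < n;
  ocar_mul : forall n m, ocar n -> 0 < m -> ocar (n * m) }.

Lemma Omega_eq (S T : Omega) : (S : set nat) = T -> S = T.
Proof.
case: S T => [S S0 Sm] [T T0 Tm] /= ST; case: _ / ST in T0 Tm *.
by rewrite (Prop_irrelevance S0 T0) (Prop_irrelevance Sm Tm).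
Qed.

Program Definition Omega_meet (S T : Omega) : Omega :=
  @MkOmega (S `&` T) _ _.
Next Obligation. by move=> S T n [/ocar_gt0]. Qed.
Next Obligation. by move=> S T n m [Sn Tn] m0; split; exact: ocar_mul. Qed.

Program Definition Omega_join (S T : Omega) : Omega :=
  @MkOmega (S `|` T) _ _.
Next Obligation. by move=> S T n [] /ocar_gt0. Qed.
Next Obligation.
by move=> S T n m [Sn|Tn] m0; [left|right]; exact: ocar_mul.
Qed.

Program Definition Omega0 : Omega := @MkOmega set0 _ _.
Next Obligation. by []. Qed.
Next Obligation. by []. Qed.

(* [None] is the infinite exponent. *)
Definition supernat := {p : nat | prime p} -> option nat.

Definition exp_le (a b : option nat) : Prop :=
  match a, b with
  | _, None => True
  | None, Some _ => False
  | Some m, Some n => m <= n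
  end.

Definition sdvd (s t : supernat) : Prop := forall p, exp_le (s p) (t p).

(* Sum of a series of natural numbers in nat extended by infinity; convergence
   is for the discrete topology of nat. *)
Definition exp_series (a : nat -> nat) : option nat :=
  let u := (fun k => \sum_(i < k) a i) : nat -> nat in
  if `[< cvg (u @ \oo) >] then Some (lim (u @ \oo)) else None.

(* The infinite formal product of the n_i, for positive integers n_i. *)
Definition sprod (n : nat -> nat) : supernat :=
  fun p => exp_series (fun i => logn (val p) (n i)).

Definition supernat_sim (s t : supernat) : Prop :=
  (forall p, s p = None <-> t p = None) /\ finite_set [set p | s p <> t p].

Lemma supernat_sim_equiv :
  equiv_class_of (fun s t : supernat => `[< supernat_sim s t >]).
Proof.
split.
- move=> s; apply/asboolP; split=> //.
  by rewrite (_ : mkset _ = set0)//; apply/seteqP; split=> p //=.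
- by move=> s t; apply/asboolP/asboolP => -[st fst]; (split;
    [by move=> p; split=> /st|by apply: sub_finite_set fst => p /=; exact: nesym]).
- move=> t s u /asboolP[st fst] /asboolP[tu ftu]; apply/asboolP; split.
    by move=> p; rewrite st tu.
  apply: (@sub_finite_set _ _ ([set p | s p <> t p] `|` [set p | t p <> u p])).
    move=> p /= su; have [stp|] := pselect (s p = t p); last by left.
    by right; rewrite -stp.
  by rewrite finite_setU.
Qed.

Canonical supernat_sim_rel := EquivRelPack supernat_sim_equiv.

Definition Sclass := {eq_quot supernat_sim_rel}.

Definition supernat_class (s : supernat) : Sclass := \pi_Sclass s.

Definition Xs (S : set nat) : set Sclass :=
  [set supernat_class s | s in
    [set s | exists n : nat -> nat, (forall i, S (n i)) /\ sdvd (sprod n) s]].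

Lemma supernat_classP (s t : supernat) :
  supernat_class s = supernat_class t <-> supernat_sim s t.
Proof.
split; first by move/eqmodP/asboolP.
by move=> st; apply/eqmodP/asboolP.
Qed.

(* Order-free criterion for an infinite product of elements of A to divide s:
   A has divisors of s avoiding the finite-exponent primes up to any bound. *)
Definition many_divisors (A : set nat) (s : supernat) : Prop :=
  forall N, exists2 a, A a & forall p m, s p = Some m ->
    logn (val p) a <= m /\ (val p <= N -> logn (val p) a = 0).

Lemma leq_psum (a : nat -> nat) j k :
  j <= k -> \sum_(i < j) a i <= \sum_(i < k) a i.
Proof.
elim: k => [|k IH]; first by rewrite leqn0 => /eqP ->.
rewrite leq_eqVlt => /predU1P[->//|]; rewrite ltnS => /IH ujk.
by apply: leq_trans ujk _; rewrite big_ord_recr leq_addr.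
Qed.

Lemma exp_series_le (a : nat -> nat) (m : nat) :
  exp_le (exp_series a) (Some m) <-> forall k, \sum_(i < k) a i <= m.
Proof.
rewrite /exp_series; set u := fun k => _.
have u_mono j k : j <= k -> u j <= u k by exact: leq_psum.
case: asboolP => [|ncv] /=.
  move=> cvu; have /(_ [set lim (u @ \oo)]) := cvu.
  move=> /(_ (discrete_set1 _)) [K _ uK] /=; split=> [lm k|lm]; last first.
    by rewrite -(uK K (leqnn K)); exact: lm.
  have lE : u (maxn K k) = lim (u @ \oo) by apply: uK; exact: leq_maxl.
  by apply: leq_trans lm; rewrite -lE; apply: u_mono; exact: leq_maxr.
split=> // um; apply: ncv.
pose P (j : nat) := `[< exists k, u k = j >].
have exP : exists j, P j by exists (u 0); apply/asboolP; exists 0.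
have ubP j : P j -> j <= m by move=> /asboolP [k <-]; exact: um.
have [j /asboolP[K uK] jmax] := ex_maxnP exP ubP.
apply/cvg_ex; exists j => A /nbhs_singleton Aj; exists K => // k /= Kk.
suff -> : u k = j by [].
apply/eqP; rewrite eqn_leq -{2}uK u_mono // andbT.
by apply: jmax; apply/asboolP; exists k.
Qed.

Lemma sdvd_sprodP (n : nat -> nat) (s : supernat) :
  sdvd (sprod n) s <->
  forall p m, s p = Some m -> forall k, \sum_(i < k) logn (val p) (n i) <= m.
Proof.
split=> [ds p m sp|ds p].
  by have := ds p; rewrite sp => /exp_series_le.
case sp: (s p) => [m|]; last by case: (sprod n p).
by apply/exp_series_le; exact: ds.
Qed.

Lemma many_divisorsP (A : set nat) (s : supernat) : (forall n, A n -> 0 < n) ->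
  (exists n : nat -> nat, (forall i, A (n i)) /\ sdvd (sprod n) s) <->
  many_divisors A s.
Proof.
move=> A0; split.
  move=> [n [An /sdvd_sprodP ds]] N.
  have zero M : M <= N.+1 -> exists K, forall i, K <= i ->
      forall p m, s p = Some m -> val p < M -> logn (val p) (n i) = 0.
    elim: M => [|M IH] MN; first by exists 0.
    have [K KP] := IH (ltnW MN).
    have [[p [Mp [m sp]]]|nop] :=
      pselect (exists p, val p = M /\ exists m, s p = Some m); last first.
      exists K => i Ki q m sq; rewrite ltnS leq_eqVlt => /predU1P[qM|].
        by exfalso; apply: nop; exists q; split=> //; exists m.
      exact: (KP i Ki q m sq).
    suff [L LP] : exists L, forall i, L <= i -> logn M (n i) = 0.
      exists (maxn K L) => i; rewrite geq_max => /andP[Ki Li] q m' sq.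
      rewrite ltnS leq_eqVlt => /predU1P[->|]; first exact: LP.
      exact: (KP i Ki q m' sq).
    have := ds p m sp; rewrite Mp => {}ds.
    have [//|nL] := pselect (exists L, forall i, L <= i -> logn M (n i) = 0).
    have big c : exists k, c <= \sum_(i < k) logn M (n i).
      elim: c => [|c [k ck]]; first by exists 0.
      have [i [ki ni]] : exists i, k <= i /\ logn M (n i) <> 0.
        apply: contrapT => H; apply: nL; exists k => i ki.
        by apply: contrapT => ni; apply: H; exists i.
      exists i.+1; rewrite big_ord_recr /= -addn1.
      have ck' := leq_trans ck (leq_psum (fun i => logn M (n i)) ki).
      by apply: leq_add => //; rewrite lt0n; exact/eqP.
    by have [k] := big m.+1; rewrite ltnNge ds.
  have [K KP] := zero N.+1 (leqnn _).
  exists (n K) => // p m sp; split; last by move=> pN; apply: (KP K _ p m sp).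
  by apply: leq_trans (ds p m sp K.+1); rewrite big_ord_recr leq_addl.
move=> /(_ _)/cid2 div.
pose f N := sval (div N).
have fA N : A (f N) by rewrite /f; case: (div N).
have fP N p m : s p = Some m ->
    logn (val p) (f N) <= m /\ (val p <= N -> logn (val p) (f N) = 0).
  by rewrite /f; case: (div N) => a /= ? ; apply.
have [B BS] : exists B, forall k, B k.+1 = maxn (B k) (f (B k)).
  by exists (fix B k := if k is k'.+1 then maxn (B k') (f (B k')) else 0).
have B_mono j k : j <= k -> B j <= B k.
  elim: k => [|k IH]; first by rewrite leqn0 => /eqP ->.
  rewrite leq_eqVlt => /predU1P[->//|]; rewrite ltnS => /IH ujk.
  by rewrite BS leq_max ujk.
exists (f \o B); split=> [i|]; first exact: fA.
apply/sdvd_sprodP => p m sp.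
have small k : (val p <= B k) || (\sum_(i < k) logn (val p) ((f \o B) i) == 0).
  elim: k => [|k /orP[IH|/eqP IH]]; first by rewrite big_ord0 eqxx orbT.
    by rewrite (leq_trans IH) // B_mono.
  rewrite big_ord_recr /= IH add0n.
  have [_|] := posnP (logn (val p) (f (B k))); first by rewrite orbT.
  rewrite logn_gt0 mem_primes => /and3P[_ f0 pf].
  by rewrite BS leq_max (dvdn_leq f0 pf) orbT.
elim=> [|k IH]; first by rewrite big_ord0.
rewrite big_ord_recr /=; have [le_m zero] := fP (B k) p m sp.
have /orP[pB|/eqP ->] := small k; last by rewrite add0n.
by rewrite zero // addn0.
Qed.

Lemma many_divisors_sim (A : set nat) (s t : supernat) :
  supernat_sim s t -> many_divisors A s -> many_divisors A t.
Proof.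
move=> [st /finite_seqP[r rE]] ds N.
have [a Aa aP] := ds (maxn N (\max_(p <- r) val p)).
exists a => // p m tp.
have [m' sp] : exists m', s p = Some m'.
  by case sp: (s p) => [m'|]; [exists m'|move/st: sp; rewrite tp].
have [le_m zero] := aP p m' sp; split; last first.
  by move=> pN; apply: zero; rewrite leq_max pN.
have [stp|stp] := pselect (s p = t p).
  by move: sp; rewrite stp tp => -[->].
rewrite zero // leq_max; apply/orP; right.
have pr : p \in r by have : [set p | s p <> t p] p by []; rewrite rE.
by rewrite (big_rem p) //= leq_maxl.
Qed.

Lemma XsP (S : Omega) (s : supernat) :
  Xs S (supernat_class s) <-> many_divisors S s.
Proof.
split=> [[t /many_divisorsP dt /supernat_classP ts]|ds].
  by apply: many_divisors_sim ts _; apply: dt; exact: ocar_gt0.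
by exists s => //; apply/many_divisorsP => //; exact: ocar_gt0.
Qed.

Lemma Sclass_ind (P : Sclass -> Prop) :
  (forall s, P (supernat_class s)) -> forall c, P c.
Proof. by move=> Ps c; rewrite -[c]reprK; exact: Ps. Qed.

Lemma Xs_setI (S T : Omega) : Xs (Omega_meet S T) = Xs S `&` Xs T.
Proof.
apply/seteqP; split=> c; elim/Sclass_ind: c => s.
  by move/XsP => ds; split; apply/XsP => N; have [a [Sa Ta] aP] := ds N;
    exists a.
move=> [/XsP dS /XsP dT]; apply/XsP => N.
have [a Sa aP] := dS N; have [b Tb bP] := dT N.
have [a0 b0] := (ocar_gt0 Sa, ocar_gt0 Tb).
exists (lcmn a b).
  split.
    have /dvdnP[k kE] := dvdn_lcml a b; rewrite kE mulnC; apply: ocar_mul => //.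
    by have := lcmn_gt0 a b; rewrite a0 b0 kE muln_gt0 => /andP[].
  have /dvdnP[k kE] := dvdn_lcmr a b; rewrite kE mulnC; apply: ocar_mul => //.
  by have := lcmn_gt0 a b; rewrite a0 b0 kE muln_gt0 => /andP[].
move=> p m sp; rewrite logn_lcm //.
have [am a_z] := aP p m sp; have [bm b_z] := bP p m sp.
by rewrite geq_max am bm; split=> // pN; rewrite a_z ?b_z.
Qed.

Lemma Xs_setU (S T : Omega) : Xs (Omega_join S T) = Xs S `|` Xs T.
Proof.
apply/seteqP; split=> c; elim/Sclass_ind: c => s; last first.
  by move=> [/XsP ds|/XsP ds]; apply/XsP => N; have [a Sa aP] := ds N;
    exists a => //; [left|right].
move/XsP => ds; have [[dS|dT]|nd] :=
    pselect (many_divisors S s \/ many_divisors T s).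
- by left; apply/XsP.
- by right; apply/XsP.
have /not_orP[/existsNP[M nM] /existsNP[N nN]] := nd.
have [a [Sa|Ta] aP] := ds (maxn M N); [case: nM|case: nN]; exists a => // p m sp;
  have [am az] := aP p m sp; split=> // pN; apply: az;
  by rewrite leq_max pN ?orbT.
Qed.

Lemma Xs_setT : Xs [set n | 0 < n] = setT.
Proof.
apply/seteqP; split=> // c _; elim/Sclass_ind: c => s.
apply/(XsP (@MkOmega [set n | 0 < n] (fun _ => id) _)).
  by move=> n m /= n0 m0; rewrite muln_gt0 n0.
by move=> N; exists 1 => // p m _; rewrite logn1.
Qed.

(* Two type synonyms for [S], carrying the sieve and the patch topology. *)
Definition Ssieve : Type := Sclass.
HB.instance Definition _ := Choice.on Ssieve.

Definition sieve_basis : set (set Ssieve) := [set Xs S | S in [set: Omega]].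

Lemma sieve_basis_cover : \bigcup_(U in sieve_basis) id U = setT.
Proof.
apply/seteqP; split=> // c _; exists (Xs [set n | 0 < n]); last by rewrite Xs_setT.
by exists (@MkOmega [set n | 0 < n] (fun _ => id)
  (fun n m n0 m0 => etrans (muln_gt0 n m) (introT andP (conj n0 m0)))).
Qed.

Lemma sieve_basis_join (U V : set Ssieve) (c : Ssieve) :
  sieve_basis U -> sieve_basis V -> id U c -> id V c ->
  exists W, [/\ sieve_basis W, id W c & id W `<=` id U `&` id V].
Proof.
move=> [S _ <-] [T _ <-] Sc Tc; exists (Xs (Omega_meet S T)); split.
- by exists (Omega_meet S T).
- by rewrite /= Xs_setI.
- by rewrite /= Xs_setI.
Qed.

HB.instance Definition _ := isBaseTopological.Build Ssieve
  sieve_basis_cover sieve_basis_join.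

Definition locally_closed (T : topologicalType) (A : set T) : Prop :=
  exists U C, [/\ open U, closed C & A = U `&` C].

Definition Spatch : Type := Sclass.
HB.instance Definition _ := Choice.on Spatch.

Definition patch_open (A : set Spatch) : Prop :=
  exists2 F : set (set Ssieve),
    F `<=` @locally_closed Ssieve & A = \bigcup_(B in F) B.

Lemma locally_closed_patch_open (A : set Ssieve) :
  locally_closed A -> patch_open A.
Proof.
move=> lA; exists [set A]; last by rewrite bigcup_set1.
by move=> _ ->.
Qed.

Lemma patch_openT : patch_open setT.
Proof.
apply: locally_closed_patch_open; exists setT, setT.
by split; [exact: openT|exact: closedT|rewrite setIT].
Qed.

Lemma patch_openI : setI_closed patch_open.
Proof.
move=> _ _ [F lF ->] [G lG ->].
exists [set B `&` C | B in F & C in G].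
  move=> _ [B FB] [C GC] <-.
  have [U [V [oU cV ->]]] := lF _ FB; have [U' [V' [oU' cV' ->]]] := lG _ GC.
  by exists (U `&` U'), (V `&` V'); split; [exact: openI|exact: closedI|
    rewrite setIACA].
apply/seteqP; split=> c.
  by move=> [[B FB Bc] [C GC Cc]]; exists (B `&` C) => //; exists B => //; exists C.
by move=> [_ [B FB] [C GC] <-] [Bc Cc]; split; [exists B|exists C].
Qed.

Lemma patch_open_bigU (I : Type) (f : I -> set Spatch) :
  (forall i, patch_open (f i)) -> patch_open (\bigcup_i f i).
Proof.
move=> fo; exists [set B : set Ssieve | locally_closed B /\ exists i, B `<=` (f i : set Sclass)].
  by move=> B [].
apply/seteqP; split=> c.
  move=> [i _]; have [F lF fE] := fo i; rewrite fE => -[B FB Bc].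
  exists B => //; split; first exact: lF.
  by exists i; rewrite fE => d Bd; exists B.
by move=> [B [_ [i Bf]] Bc]; exists i => //; exact: Bf.
Qed.

HB.instance Definition _ := isOpenTopological.Build Spatch
  patch_openT patch_openI patch_open_bigU.

Lemma open_sieve_Xs (S : Omega) : open (Xs S : set Ssieve).
Proof.
by exists [set (Xs S : set Ssieve)]; [move=> _ ->; exists S|rewrite bigcup_set1].
Qed.

Lemma open_patch_Xs (S : Omega) : open (Xs S : set Spatch).
Proof.
apply: locally_closed_patch_open; exists (Xs S), setT.
by split; [exact: open_sieve_Xs|exact: closedT|rewrite setIT].
Qed.

Lemma open_patch_XsC (S : Omega) : open (~` Xs S : set Spatch).
Proof.
apply: locally_closed_patch_open; exists setT, (~` Xs S).
split; [exact: openT| |by rewrite setTI].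
by apply: open_closedC; exact: open_sieve_Xs.
Qed.

(* The point c, seen in the subtype associated with A. *)
Definition pt {T : Type} {A : set T} {c : T} (Ac : A c) : A :=
  exist _ c (mem_set Ac).

Lemma pt_val (T : Type) (A : set T) (u : A) (Au : A (set_val u)) : pt Au = u.
Proof. exact: val_inj. Qed.

(* Constructible truth fluctuations over Xs S: the set Xs S has the topology
   induced by the patch topology, and bool, for {0,1}, the discrete one. *)
Record Gamma (S : Omega) := MkGamma {
  gfun :> (Xs S : set Spatch) -> bool;
  gcont : continuous gfun }.

Lemma Gamma_eq (S : Omega) (x y : Gamma S) : (gfun x) = y -> x = y.
Proof.
case: x y => [x cx] [y cy] /= xy; case: _ / xy in cy *.
by rewrite (Prop_irrelevance cx cy).
Qed.

Lemma continuous_boolP (T : topologicalType) (A : set T) (x : A -> bool) :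
  open A -> continuous x <->
  forall b, open [set c | exists Ac : A c, x (pt Ac) = b].
Proof.
move=> oA; split=> [cx b|ox].
  have : open (x @^-1` [set b]).
    by apply: open_comp; [move=> ? _; exact: cx|exact: discrete_open].
  move=> [U oU UE].
  rewrite (_ : mkset _ = A `&` U); first exact: openI.
  apply/seteqP; split=> c.
    move=> [Ac xc]; split=> //.
    by have : (x @^-1` [set b]) (pt Ac) by []; rewrite -UE.
  move=> [Ac Uc]; exists Ac.
  by have : (set_val @^-1` U) (pt Ac) by []; rewrite UE.
move=> u B /nbhs_singleton Bu.
rewrite nbhs_simpl /= nbhsE /=.
exists (set_val @^-1` [set c | exists Ac : A c, x (pt Ac) = x u]).
  split; first by exists [set c | exists Ac : A c, x (pt Ac) = x u].
  by exists (set_valP u); rewrite pt_val.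
by move=> v [Av]; rewrite pt_val /= => ->.
Qed.

Lemma Xs_meetl (S T : Omega) : Xs (Omega_meet S T) `<=` Xs S.
Proof. by rewrite Xs_setI => c []. Qed.

Lemma Xs_joinl (S T : Omega) (c : Sclass) :
  Xs (Omega_join S T) c -> ~ Xs T c -> Xs S c.
Proof. by rewrite Xs_setU => -[]. Qed.

(* The restriction of x to Xs (S n T) = Xs S n Xs T (lemma Xs_setI). *)
Definition meet_fun (S T : Omega) (x : Gamma S)
    (u : (Xs (Omega_meet S T) : set Spatch)) : bool :=
  x (pt (Xs_meetl (set_valP u))).

(* y on Xs T and x on Xs S - Xs T; their union is Xs (S u T) (lemma Xs_setU). *)
Definition join_fun (S T : Omega) (x : Gamma S) (y : Gamma T)
    (u : (Xs (Omega_join S T) : set Spatch)) : bool :=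
  match pselect (Xs T (set_val u)) with
  | left Tu => y (pt Tu)
  | right nTu => x (pt (Xs_joinl (set_valP u) nTu))
  end.

Lemma Gamma_openP (S : Omega) (x : (Xs S : set Spatch) -> bool) :
  continuous x <->
  forall b, open [set c : Spatch | exists Sc : Xs S c, x (pt Sc) = b].
Proof. exact/continuous_boolP/open_patch_Xs. Qed.

Lemma meet_fun_continuous (S T : Omega) (x : Gamma S) :
  continuous (@meet_fun S T x).
Proof.
apply/Gamma_openP => b.
have /Gamma_openP/(_ b) ox := gcont (g := x).
rewrite (_ : mkset _ = [set c : Spatch | exists Sc : Xs S c, x (pt Sc) = b] `&`
    Xs (Omega_meet S T)); first exact: openI (open_patch_Xs _).
apply/seteqP; split=> c.
  by move=> [Ac xc]; split=> //; exists (Xs_meetl Ac); rewrite -xc; congr (x _);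
    exact: val_inj.
move=> [[Sc xc] Ac]; exists Ac; rewrite -xc; congr (x _); exact: val_inj.
Qed.

Lemma join_fun_continuous (S T : Omega) (x : Gamma S) (y : Gamma T) :
  continuous (join_fun x y).
Proof.
apply/Gamma_openP => b.
have /Gamma_openP/(_ b) ox := gcont (g := x).
have /Gamma_openP/(_ b) oy := gcont (g := y).
rewrite (_ : mkset _ = [set c : Spatch | exists Tc : Xs T c, y (pt Tc) = b] `|`
  ([set c : Spatch | exists Sc : Xs S c, x (pt Sc) = b] `&` ~` Xs T)); last first.
  apply/seteqP; split=> c.
    move=> [Ac]; rewrite /join_fun; case: pselect => [Tc yc|nTc xc].
      by left; exists Tc.
    by right; split=> //; exists (Xs_joinl (set_valP (pt Ac)) nTc).
  move=> [[Tc yc]|[[Sc xc] nTc]].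
    have Ac : Xs (Omega_join S T) c by rewrite Xs_setU; right.
    exists Ac; rewrite /join_fun; case: pselect => [Tc'|//].
    by rewrite -yc; congr (y _); exact: val_inj.
  have Ac : Xs (Omega_join S T) c by rewrite Xs_setU; left.
  exists Ac; rewrite /join_fun; case: pselect => [//|nTc'].
  by rewrite -xc; congr (x _); exact: val_inj.
by apply: openU => //; apply: openI => //; exact: open_patch_XsC.
Qed.

Lemma cst_fun_continuous (S : Omega) (b : bool) :
  continuous (fun _ : (Xs S : set Spatch) => b).
Proof. exact: cst_continuous. Qed.

Record Theta := MkTheta { tset : Omega; tsec : Gamma tset }.

Definition Theta_meet (a b : Theta) : Theta :=
  MkTheta (MkGamma (@meet_fun_continuous (tset a) (tset b) (tsec a))).

Definition Theta_join (a b : Theta) : Theta :=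
  MkTheta (MkGamma (@join_fun_continuous _ _ (tsec a) (tsec b))).

Definition Theta_one (S : Omega) : Theta :=
  MkTheta (MkGamma (@cst_fun_continuous S true)).

Lemma Xs0 (c : Sclass) : ~ Xs Omega0 c.
Proof. by move=> [s [n [n0 _]] _]; exact: n0 0. Qed.

Definition empty_fun (u : (Xs Omega0 : set Spatch)) : bool :=
  match Xs0 (set_valP u) with end.

Lemma empty_fun_continuous : continuous empty_fun.
Proof. by move=> u; case: (Xs0 (set_valP u)). Qed.

Definition Theta0 : Theta := MkTheta (MkGamma empty_fun_continuous).

Record is_ncframe (A : Type) (meet join : A -> A -> A) (zero : A) : Prop :=
  IsNCFrame {
  nc_meetA : forall x y z, meet x (meet y z) = meet (meet x y) z;
  nc_joinA : forall x y z, join x (join y z) = join (join x y) z;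
  nc_meetxx : forall x, meet x x = x;
  nc_joinxx : forall x, join x x = x;
  nc_absorbl : forall x y, meet x (join x y) = x /\ x = join x (meet x y);
  nc_absorbr : forall x y, meet (join y x) x = x /\ x = join (meet y x) x;
  nc_meet0 : forall x, meet x zero = zero /\ zero = meet zero x;
  nc_join0 : forall x, join x zero = x /\ x = join zero x;
  nc_meetDr : forall x y z, meet x (join y z) = join (meet x y) (meet x z);
  nc_meetDl : forall x y z, meet (join y z) x = join (meet y x) (meet z x);
  nc_meet_lreg : forall x y, meet (meet x y) x = meet x y;
  nc_join_rreg : forall x y, join (join x y) x = join y x;
  nc_meet_lnormal : forall x y z, meet (meet x y) z = meet (meet x z) y }.

Record ncframe := NCFrame {
  ncsort :> Type;
  ncmeet : ncsort -> ncsort -> ncsort;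
  ncjoin : ncsort -> ncsort -> ncsort;
  nczero : ncsort;
  ncax : is_ncframe ncmeet ncjoin nczero }.

Definition nc_embedding (F G : ncframe) (f : F -> G) : Prop :=
  [/\ injective f,
      {morph f : x y / ncmeet x y >-> ncmeet x y},
      {morph f : x y / ncjoin x y >-> ncjoin x y} &
      f (nczero F) = nczero G].

Section Shadow.
Variable F : ncframe.
Local Notation "x ∧ y" := (ncmeet x y) (at level 40, left associativity).
Local Notation "x ∨ y" := (ncjoin x y) (at level 40, left associativity).

Definition ncsim (x y : F) : Prop := x ∧ y ∧ x = x /\ y ∧ x ∧ y = y.

Lemma ncsimE (x y : F) : ncsim x y <-> x ∧ y = x /\ y ∧ x = y.
Proof. by rewrite /ncsim !(nc_meet_lreg (ncax F)). Qed.

Lemma ncsim_equiv :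
  equiv_class_of (fun x y : {classic F} => `[< ncsim x y >]).
Proof.
have ax := ncax F; split.
- by move=> x; apply/asboolP/ncsimE; rewrite (nc_meetxx ax).
- by move=> x y; apply/asboolP/asboolP => -[].
- move=> y x z /asboolP/ncsimE[xy yx] /asboolP/ncsimE[yz zy].
  apply/asboolP/ncsimE; split.
    by rewrite -{1}xy -(nc_meetA ax) yz.
  by rewrite -{1}zy -(nc_meetA ax) yx.
Qed.

Canonical ncsim_rel := EquivRelPack ncsim_equiv.

Definition shadow := {eq_quot ncsim_rel}.

Definition shadow_class (x : F) : shadow := \pi_shadow (x : {classic F}).

Definition shadow_meet (a b : shadow) : shadow :=
  shadow_class ((repr a : F) ∧ (repr b : F)).

Definition shadow_join (a b : shadow) : shadow :=
  shadow_class ((repr a : F) ∨ (repr b : F)).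

Lemma shadow_classP (x y : F) : shadow_class x = shadow_class y <-> ncsim x y.
Proof.
split; first by move/eqmodP/asboolP.
by move=> xy; apply/eqmodP/asboolP.
Qed.

Lemma repr_shadow (x : F) : ncsim (repr (shadow_class x)) x.
Proof. by apply/shadow_classP; exact: reprK. Qed.

Lemma shadow_meetE (x y : F) :
  shadow_meet (shadow_class x) (shadow_class y) = shadow_class (x ∧ y).
Proof.
have ax := ncax F.
have le x1 x2 y1 y2 : x1 ∧ x2 = x1 -> y1 ∧ y2 = y1 ->
    (x1 ∧ y1) ∧ (x2 ∧ y2) = x1 ∧ y1 :> F.
  move=> xx yy; rewrite (nc_meetA ax) (nc_meet_lnormal ax x1) xx.
  by rewrite -(nc_meetA ax) yy.
have /ncsimE[x1 x2] := repr_shadow x; have /ncsimE[y1 y2] := repr_shadow y.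
by apply/shadow_classP/ncsimE; split; exact: le.
Qed.

Lemma shadow_joinE (x y : F) :
  shadow_join (shadow_class x) (shadow_class y) = shadow_class (x ∨ y).
Proof.
have ax := ncax F.
have le x1 x2 y1 y2 : x1 ∧ x2 = x1 -> y1 ∧ y2 = y1 ->
    (x1 ∨ y1) ∧ (x2 ∨ y2) = x1 ∨ y1 :> F.
  move=> xx yy; rewrite (nc_meetDl ax); congr (_ ∨ _).
    by rewrite -{1}xx -(nc_meetA ax) (nc_absorbl ax _ _).1.
  by rewrite -{1}yy (nc_meet_lnormal ax) -(nc_meetA ax) (nc_absorbr ax _ _).1.
have /ncsimE[x1 x2] := repr_shadow x; have /ncsimE[y1 y2] := repr_shadow y.
by apply/shadow_classP/ncsimE; split; exact: le.
Qed.

End Shadow.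

Definition lattice_iso (A B : Type) (mA jA : A -> A -> A)
    (mB jB : B -> B -> B) (f : A -> B) : Prop :=
  [/\ bijective f,
      {morph f : x y / mA x y >-> mB x y} &
      {morph f : x y / jA x y >-> jB x y}].

Lemma Omega_is_ncframe : is_ncframe Omega_meet Omega_join Omega0.
Proof.
have mC S T : Omega_meet S T = Omega_meet T S.
  by apply: Omega_eq; exact: setIC.
have jC S T : Omega_join S T = Omega_join T S.
  by apply: Omega_eq; exact: setUC.
split=> *; try split; apply: Omega_eq => /=;
  by apply/seteqP; split=> n /=; tauto.
Qed.

Definition Omega_frame : ncframe := NCFrame Omega_is_ncframe.

Definition Xnc (a : Theta) : set (Sclass * bool) :=
  [set (set_val u, tsec a u) | u in [set: (Xs (tset a) : set Spatch)]].

(* The set [S] x {0,1}, with the topology generated by the sets Xnc a. *)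
Definition Espace : Type := (Sclass * bool)%type.
HB.instance Definition _ := Choice.on Espace.
HB.instance Definition _ :=
  isSubBaseTopological.Build Espace [set Xnc a | a in [set: Theta]] id.

Definition Eproj (e : Espace) : Spatch := e.1.

(* f makes X into an etale space over Y. *)
Definition local_homeomorphism (X Y : topologicalType) (f : X -> Y) : Prop :=
  forall x : X, exists U : set X,
    [/\ open U, U x, open (f @` U) &
        {within U, continuous f} /\
        exists g : Y -> X,
          {within f @` U, continuous g} /\ (forall z, U z -> g (f z) = z)].

(* Main.v *)
Require Import Defs.
From HB Require Import structures.
From mathcomp Require Import all_boot all_classical.
From mathcomp Require Import topology.

(** A pair (S, x) is determined by the ideal S together with the partial
    function on supernatural classes that equals x on X_s(S) and is undefined
    elsewhere.  In these terms the two operations are computed at each class c separately: the meet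
    keeps the first value when the second one is defined, and the join keeps
    the second value if there is one and the first otherwise.  Hence Theta is
    a subalgebra of the product of the distributive lattice Omega with a power
    of a three-element algebra (undefined, 0, 1), namely [option bool] with
    [opt_meet] and [opt_join] ([Theta_eqP], [tval_meet], [tval_join]).  The
    axioms of a noncommutative frame are identities, so they hold in Theta
    because they hold in Omega and, by inspection of cases, in [option bool].
    In the same way two elements of Theta commute if and only if at each class
    their values commute in [option bool], which means that they do not differ
    where both are defined.

    The relation x /\ y = x and y /\ x = y only sees the ideals, since the meet
    takes its values from its first argument.  Therefore the shadow is Omega,
    with the constant sections as representatives ([Theta_ncsim]).

    For the etale space, consider the sheet of all points (d, b), for a fixed
    b: it is the open set of the constant section b over the largest ideal.  The projection is injective on
    it and maps it onto the base.  The inverse d |-> (d, b) is continuous because the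
    preimage of X_nc(S, x) is the set where x takes the value b, which is patch
    open by continuity of x.  The projection is continuous on the sheet because
    the sheet over a locally closed set is open.  Indeed a sieve-closed set C is
    patch clopen: as a closed set it is locally closed, and its complement is
    open.  The function equal to b exactly on C is thus a section over any
    X_s(S), and the intersection of its graph with the sheet lies over
    X_s(S) and C ([open_sheet]). *)

Set Implicit Arguments.
Unset Strict Implicit.
Unset Printing Implicit Defensive.

Local Open Scope classical_set_scope.

(** * Elements of Theta as partial functions *)

Definition opt_meet (o p : option bool) := if p is Some _ then o else None.

Definition opt_join (o p : option bool) := if p is Some _ then p else o.

Lemma opt_meetC (o p : option bool) : opt_meet o p = opt_meet p o <->
  forall u v, o = Some u -> p = Some v -> u = v.
Proof.
case: o p => [u|] [v|] /=; split=> //.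
- by move=> [->] _ _ [<-] [<-].
- by move=> /(_ u v erefl erefl) ->.
Qed.

Lemma opt_joinC (o p : option bool) : opt_join o p = opt_join p o <->
  forall u v, o = Some u -> p = Some v -> u = v.
Proof.
case: o p => [u|] [v|] /=; split=> //.
- by move=> [->] _ _ [<-] [<-].
- by move=> /(_ u v erefl erefl) ->.
Qed.

(** Partial functions are total functions into [option bool], so that values
    at a class can be compared without transporting along the proofs of
    membership that the domain subtypes of sections carry. *)
Definition tval (a : Theta) (c : Sclass) : option bool :=
  if pselect (Xs (tset a) c) is left ac then Some (tsec a (pt ac)) else None.

Lemma tvalE (a : Theta) (c : Sclass) (ac : Xs (tset a) c) :
  tval a c = Some (tsec a (pt ac)).
Proof.
rewrite /tval; case: pselect => // ac'; congr (Some (tsec a _)).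
exact: val_inj.
Qed.

Lemma tvalN (a : Theta) (c : Sclass) : ~ Xs (tset a) c -> tval a c = None.
Proof. by rewrite /tval; case: pselect. Qed.

Lemma tval_Some (a : Theta) (c : Sclass) (b : bool) :
  tval a c = Some b <-> exists ac : Xs (tset a) c, tsec a (pt ac) = b.
Proof.
split=> [|[ac <-]]; last exact: tvalE.
by rewrite /tval; case: pselect => // ac [<-]; exists ac.
Qed.

Lemma Theta_eqP (a b : Theta) :
  a = b <-> (tset a : set nat) = tset b /\ forall c, tval a c = tval b c.
Proof.
split=> [->//|[]]; case: a b => [S x] [T y] /= /Omega_eq ST.
case: _ / ST in y * => xy; congr MkTheta; apply: Gamma_eq.
apply/funext => u; have Su : Xs S (set_val u) := set_valP u.
have := xy (set_val u); rewrite !(tvalE (a := MkTheta _) Su) /=.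
by rewrite !pt_val => -[].
Qed.

Lemma tval_meet (a b : Theta) (c : Sclass) :
  tval (Theta_meet a b) c = opt_meet (tval a c) (tval b c).
Proof.
have [[ac bc]|nabc] := pselect ((Xs (tset a) `&` Xs (tset b)) c).
  have abc : Xs (tset (Theta_meet a b)) c by rewrite Xs_setI.
  rewrite (tvalE abc) (tvalE ac) (tvalE bc) /= /meet_fun.
  by congr (Some (tsec a _)); exact: val_inj.
rewrite tvalN; last by rewrite Xs_setI.
have [ac|nac] := pselect (Xs (tset a) c); last first.
  by rewrite (tvalN nac) /opt_meet; case: (tval b c).
by rewrite [tval b c]tvalN // => bc; apply: nabc.
Qed.

Lemma tval_join (a b : Theta) (c : Sclass) :
  tval (Theta_join a b) c = opt_join (tval a c) (tval b c).
Proof.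
have [abc|] := pselect (Xs (tset (Theta_join a b)) c); last first.
  move=> nabc; rewrite (tvalN nabc); move: nabc; rewrite Xs_setU.
  by move=> /not_orP[nac nbc]; rewrite !tvalN.
rewrite (tvalE abc) /= /join_fun; case: pselect => [bc|nbc].
  by rewrite (tvalE bc).
by rewrite (tvalN nbc) /= -tvalE.
Qed.

Lemma tval0 (c : Sclass) : tval Theta0 c = None.
Proof. by apply: tvalN; exact: Xs0. Qed.

(** * The noncommutative frame and its shadow *)

(** Every axiom is an identity between terms.  It splits into an identity of
    sets, which is propositional logic at each integer, and an identity in
    [option bool], which has at most 27 instances. *)
Lemma Theta_is_ncframe : is_ncframe Theta_meet Theta_join Theta0.
Proof.
split=> *; try split; apply/Theta_eqP;
  (split; [apply/seteqP; split=> n /=; tauto|move=> c]);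
  rewrite ?(tval_meet, tval_join, tval0);
  by repeat case: (tval _ c) => [?|].
Qed.

(** The order compares ideals only, because a meet takes its values from its
    first argument and restricting a section to its own domain changes
    nothing. *)
Lemma Theta_meet_idPl (a b : Theta) :
  Theta_meet a b = a <-> (tset a : set nat) `<=` tset b.
Proof.
split=> [<- n []//|ab]; apply/Theta_eqP.
have aE : ocar (Omega_meet (tset a) (tset b)) = tset a by exact/setIidPl.
split=> // c; rewrite tval_meet.
have [ac|nac] := pselect (Xs (tset a) c); last first.
  by rewrite (tvalN nac) /opt_meet; case: (tval b c).
have [_ bc] : (Xs (tset a) `&` Xs (tset b)) c by rewrite -Xs_setI aE.
by rewrite (tvalE bc).
Qed.

Definition Theta_frame : ncframe := NCFrame Theta_is_ncframe.

Lemma Theta_ncsim (a b : Theta) :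
  ncsim (a : Theta_frame) b <-> tset a = tset b.
Proof.
rewrite ncsimE; split=> [[/Theta_meet_idPl ab /Theta_meet_idPl ba]|ab].
  by apply: Omega_eq; apply/seteqP.
by split; apply/Theta_meet_idPl; rewrite ab.
Qed.

Definition shadow_ideal (q : shadow Theta_frame) : Omega :=
  tset (repr q : Theta).

Lemma shadow_idealE (a : Theta) :
  shadow_ideal (shadow_class (a : Theta_frame)) = tset a.
Proof. exact/Theta_ncsim/repr_shadow. Qed.

Lemma shadow_class_repr (q : shadow Theta_frame) :
  shadow_class (repr q : Theta_frame) = q.
Proof. exact: reprK. Qed.

(** By [Theta_ncsim] the ideal is a complete invariant of a shadow class, and
    every ideal is reached, for instance by a constant section. *)
Lemma shadow_ideal_iso :
  lattice_iso (@shadow_meet Theta_frame) (@shadow_join Theta_frame)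
    Omega_meet Omega_join shadow_ideal.
Proof.
split.
- exists (fun S => shadow_class (Theta_one S : Theta_frame)) => [q|S].
    by rewrite -[RHS]shadow_class_repr; apply/shadow_classP/Theta_ncsim.
  by rewrite shadow_idealE.
- by move=> q r; rewrite [LHS]shadow_idealE.
- by move=> q r; rewrite [LHS]shadow_idealE.
Qed.

Definition Theta_cst (S : Omega) (b : bool) : Theta :=
  MkTheta (MkGamma (@cst_fun_continuous S b)).

Lemma tval_cst (S : Omega) (b : bool) (c : Sclass) :
  tval (Theta_cst S b) c = if `[< Xs S c >] then Some b else None.
Proof.
by case: asboolP => Sc; [rewrite (tvalE (a := Theta_cst S b) Sc)|exact: tvalN].
Qed.

(** A join of constant functions is computed by gluing, so its domain has to be
    compared with the union of the two domains. *)
Lemma Theta_one_embedding : @nc_embedding Omega_frame Theta_frame Theta_one.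
Proof.
have one S c : tval (Theta_one S) c = if `[< Xs S c >] then Some true else None.
  exact: tval_cst.
split.
- by move=> S T [].
  (* The restriction of a constant function is convertible to the constant. *)
- by move=> S T; apply/Theta_eqP.
- move=> S T; apply/Theta_eqP; split=> // c.
  rewrite [RHS]tval_join [LHS]one !one Xs_setU asbool_or.
  by case: asboolP => _; case: asboolP.
- apply/Theta_eqP; split=> // c.
  by rewrite [RHS]tval0 tvalN //; exact: Xs0.
Qed.

(** * Commuting elements *)

Lemma agreeP (S T : Omega) (x : Gamma S) (y : Gamma T) :
  (forall c (Sc : Xs S c) (Tc : Xs T c), x (pt Sc) = y (pt Tc)) <->
  (forall c u v, tval (MkTheta x) c = Some u -> tval (MkTheta y) c = Some v ->
    u = v).
Proof.
split=> [xy c u v /tval_Some[Sc <-] /tval_Some[Tc <-]|xy c Sc Tc].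
  exact: xy.
by apply: (xy c); apply/tval_Some; [exists Sc|exists Tc].
Qed.

Lemma Theta_meetCP (a b : Theta) : Theta_meet a b = Theta_meet b a <->
  forall c u v, tval a c = Some u -> tval b c = Some v -> u = v.
Proof.
split=> [/Theta_eqP[_ ab] c|ab].
  by apply/opt_meetC; rewrite -!tval_meet.
apply/Theta_eqP; split=> [|c]; first exact: setIC.
by rewrite !tval_meet; apply/opt_meetC => u v; exact: ab.
Qed.

Lemma Theta_joinCP (a b : Theta) : Theta_join a b = Theta_join b a <->
  forall c u v, tval a c = Some u -> tval b c = Some v -> u = v.
Proof.
split=> [/Theta_eqP[_ ab] c|ab].
  by apply/opt_joinC; rewrite -!tval_join.
apply/Theta_eqP; split=> [|c]; first exact: setUC.
by rewrite !tval_join; apply/opt_joinC => u v; exact: ab.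
Qed.

(** * The etale space *)

Lemma XncP (a : Theta) (c : Sclass) (b : bool) :
  Xnc a (c, b) <-> tval a c = Some b.
Proof.
split=> [[u _ [<- <-]]|/tval_Some[ac <-]].
  by apply/tval_Some; exists (set_valP u); rewrite pt_val.
by exists (pt ac).
Qed.

Lemma open_Xnc (a : Theta) : open (Xnc a : set Espace).
Proof.
exists [set Xnc a]; last exact: bigcup_set1.
by move=> _ ->; apply: (@finI_from1 _ _ _ id); exists a.
Qed.

Lemma sieve_open_patch_open (A : set Ssieve) :
  open A -> open (A : set Spatch).
Proof.
move=> oA; apply: locally_closed_patch_open; exists A, setT.
by split; [|exact: closedT|rewrite setIT].
Qed.

Lemma sieve_closed_patch_open (C : set Ssieve) :
  closed C -> open (C : set Spatch).
Proof.
move=> cC; apply: locally_closed_patch_open; exists setT, C.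
by split; [exact: openT| |rewrite setTI].
Qed.

Definition indic_fun (S : Omega) (C : set Sclass) (b : bool)
    (u : (Xs S : set Spatch)) : bool :=
  if `[< C (set_val u) >] then b else ~~ b.

(** A sieve-closed set is clopen for the patch topology, even when it is an
    infinite intersection of complements of basic open sets.  This supplies
    enough sections for every patch-open set to lift to each sheet. *)
Lemma indic_fun_continuous (S : Omega) (C : set Ssieve) (b : bool) :
  closed C -> continuous (@indic_fun S C b).
Proof.
move=> cC; apply/Gamma_openP => b'.
rewrite (_ : mkset _ =
    (Xs S : set Spatch) `&` (if b' == b then C else ~` C)); last first.
  apply/seteqP; split=> c; rewrite /indic_fun.
    move=> [Sc <-]; split=> //=; case: asboolP => // Cc; first by rewrite eqxx.
    by rewrite ifN //; case: (b).
  move=> [Sc]; have [->|bb'] := eqVneq b' b => Cc; exists Sc => /=.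
    by rewrite asboolT.
  by rewrite asboolF //; case: b' b bb' {Cc} => -[].
apply: openI; first exact: open_patch_Xs.
case: ifP => _; first exact: sieve_closed_patch_open.
by apply: sieve_open_patch_open; exact: closed_openC.
Qed.

(** It suffices to cut out the sheet over X_s(S) and C.  The graph of
    [indic_fun S C b] meets the sheet exactly there, but it also contains points
    of the other sheet; intersecting with the graph of the constant b removes
    them. *)
Lemma open_sheet_locally_closed (B : set Ssieve) (b : bool) :
  locally_closed B -> open ([set e | B e.1 /\ e.2 = b] : set Espace).
Proof.
move=> [U [C [[D DU UE] cC ->]]].
rewrite (_ : mkset _ = \bigcup_(S in [set S : Omega | Xs S `<=` U])
    (Xnc (MkTheta (MkGamma (@indic_fun_continuous S C b cC))) `&`
     Xnc (Theta_cst S b) : set Espace)).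
  by apply: bigcup_open => S _; apply: openI; exact: open_Xnc.
apply/seteqP; split=> -[c b'] /=.
  move=> [[Uc Cc] ->]; move: Uc; rewrite -UE => -[V DV Vc].
  have [S _ SV] := DU _ DV; rewrite -SV in Vc.
  exists S; first by rewrite /= SV => d Vd; exists V.
  split; apply/XncP; last by rewrite tval_cst asboolT.
  by apply/tval_Some; exists Vc; rewrite /= /indic_fun asboolT.
move=> [S SU [/XncP/tval_Some[Sc]]]; rewrite /= /indic_fun /= => xc.
move=> /XncP; rewrite tval_cst asboolT // => -[bb']; rewrite -bb' in xc *.
split=> //; split; first exact: SU.
by move: xc; case: asboolP => //; case: (b).
Qed.

Lemma open_sheet (B : set Spatch) (b : bool) :
  open B -> open ([set e | B e.1 /\ e.2 = b] : set Espace).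
Proof.
move=> [F lF ->].
rewrite (_ : mkset _ =
    \bigcup_(A in F) ([set e | A e.1 /\ e.2 = b] : set Espace)).
  by apply: bigcup_open => A FA; apply: open_sheet_locally_closed; exact: lF.
apply/seteqP; split=> e; first by move=> [[A FA Ae] eb]; exists A.
by move=> [A FA [Ae eb]]; split=> //; exists A.
Qed.

Lemma open_Xnc_fiber (a : Theta) (b : bool) :
  open ([set c | Xnc a (c, b)] : set Spatch).
Proof.
have /Gamma_openP/(_ b) := gcont (g := tsec a); congr open.
by apply/seteqP; split=> c /=; rewrite XncP tval_Some.
Qed.

(** Preimages commute with unions and with intersections, so it is enough to
    consider the subbase of graphs, which is [open_Xnc_fiber]. *)
Lemma sheet_section_continuous (b : bool) :
  continuous (fun c : Spatch => (c, b) : Espace).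
Proof.
apply/continuousP => _ [F subF <-]; rewrite preimage_bigcup.
apply: bigcup_open => _ /subF [X subX <-].
rewrite preimage_bigcap bigcap_fset big_seq.
apply: big_ind => [|A B oA oB|A /subX]; [exact: openT|exact: openI|].
by rewrite inE => -[a _ <-]; exact: open_Xnc_fiber.
Qed.

(** The neighbourhood of (c, b) is its whole sheet, on which the projection has
    the inverse d |-> (d, b). *)
Lemma Eproj_local_homeomorphism : local_homeomorphism Eproj.
Proof.
move=> [c b]; exists [set e | [set: Spatch] e.1 /\ e.2 = b].
have oU := open_sheet b (@openT Spatch).
have projU : Eproj @` [set e : Espace | [set: Spatch] e.1 /\ e.2 = b] = setT.
  by apply/seteqP; split=> // d _; exists (d, b).
split=> //; first by rewrite projU; exact: openT.
split.
  rewrite continuous_open_subspace //; apply/continuous_inP => // B oB.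
  rewrite (_ : _ `&` _ = [set e | B e.1 /\ e.2 = b]); first exact: open_sheet.
  by apply/seteqP; split=> e /= [] => [[_ eb] Be|Be eb].
exists (fun d => (d, b)); split; last by move=> [d b'] [_ /= ->].
apply: continuous_subspaceT; exact: sheet_section_continuous.
Qed.

Theorem theorem4 :
  (* (a) and (b) *)
  (exists ax : is_ncframe Theta_meet Theta_join Theta0,
     (exists phi : shadow (NCFrame ax) -> Omega,
        lattice_iso (@shadow_meet (NCFrame ax)) (@shadow_join (NCFrame ax))
          Omega_meet Omega_join phi) /\
     @nc_embedding Omega_frame (NCFrame ax) Theta_one) /\
  (* (c) *)
  (forall (S T : Omega) (x : Gamma S) (y : Gamma T),
     let agree := forall (c : Sclass) (Sc : Xs S c) (Tc : Xs T c),
       x (pt Sc) = y (pt Tc) in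
     (Theta_meet (MkTheta x) (MkTheta y) = Theta_meet (MkTheta y) (MkTheta x)
       <-> agree) /\
     (Theta_join (MkTheta x) (MkTheta y) = Theta_join (MkTheta y) (MkTheta x)
       <-> agree)) /\
  (* (d) *)
  local_homeomorphism Eproj.
Proof.
split; last split; last exact: Eproj_local_homeomorphism.
  exists Theta_is_ncframe; split; last exact: Theta_one_embedding.
  by exists shadow_ideal; exact: shadow_ideal_iso.
by move=> S T x y agree; rewrite Theta_meetCP Theta_joinCP /agree agreeP.
Qed.
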